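(* Let $X,Y$ be real Hilbert spaces, $K:X\to Y$ a bounded linear operator with adjoint $K^*$, $\gamma,\rho\ge0$ the convexity constants of the convex functions $G:X\to\mathbb R$ and $F^*:Y\to\mathbb R$, which are twice continuously differentiable. Let $(\phi,\psi,\theta,x,y,\zeta,\eta)$ on $[0,\infty)$, with $\phi,\psi,\theta>0$, solve $$\begin{cases}\phi'=2\gamma\theta,\quad \psi'=2\rho\theta,\quad \theta'=\theta,\\ x'=\zeta-x,\quad y'=\eta-y,\\ \phi\,\zeta'=\theta\left[\gamma(x-\zeta)-\nabla G(x)-K^*\eta\right],\\ \psi\,\eta'=\theta\left[\rho(y-\eta)-\nabla F^*(y)+K\zeta\right],\end{cases}$$ (derivatives in $t$), and let $(\widetilde\phi,\widetilde\psi,\widetilde\theta,\widetilde x,\widetilde y,\widetilde\zeta,\widetilde\eta)$ on $[0,\infty)$, with $\widetilde\phi,\widetilde\psi,\widetilde\theta>0$, solve $$\begin{cases}\widetilde\phi'=2\gamma\sqrt{\widetilde\phi\widetilde\psi},\quad \widetilde\psi'=2\rho\sqrt{\widetilde\phi\widetilde\psi},\quad \widetilde\theta'=\sqrt{\widetilde\phi\widetilde\psi},\\ \widetilde\theta\,\widetilde x'=\widetilde\theta'\,(\widetilde\zeta-\widetilde x),\quad \widetilde\theta\,\widetilde y'=\widetilde\theta'\,(\widetilde\eta-\widetilde y),\\ \sqrt{\widetilde\phi}\,\widetilde\zeta'=\sqrt{\widetilde\psi}\left[\gamma(\widetilde x-\widetilde\zeta)-\nabla G(\widetilde x)-K^*\widetilde\eta\right],\\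 \sqrt{\widetilde\psi}\,\widetilde\eta'=\sqrt{\widetilde\phi}\left[\rho(\widetilde y-\widetilde\eta)-\nabla F^*(\widetilde y)+K\widetilde\zeta\right],\end{cases}$$ (derivatives in $s$), with the same initial values at time $0$. Set $t(s)=\ln\widetilde\theta(s)-\ln\widetilde\theta(0)$. Then for all $s\ge0$, $$\widetilde\phi(s)=\phi(t(s)),\quad\widetilde\psi(s)=\psi(t(s)),\quad\widetilde\theta(s)=\theta(t(s)),$$ $$\widetilde x(s)=x(t(s)),\quad\widetilde y(s)=y(t(s)),\quad\widetilde\zeta(s)=\zeta(t(s)),\quad\widetilde\eta(s)=\eta(t(s)).$$
   Context: $F^*$ denotes the Fenchel conjugate of a proper lower semicontinuous convex function $F:Y\to(-\infty,+\infty]$. That $G$ has convexity constant $\gamma\ge0$ means $x\mapsto G(x)-\frac{\gamma}{2}\|x\|^2$ is convex; similarly for $F^*$ and $\rho$. *)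

(* Defs.v *)
From HB Require Import structures.
From mathcomp Require Import all_boot all_order all_algebra.
From mathcomp Require Import all_classical all_reals all_analysis.

Set Implicit Arguments.
Unset Strict Implicit.
Unset Printing Implicit Defensive.

Import Order.TTheory GRing.Theory Num.Theory.
Import numFieldNormedType.Exports.

Local Open Scope classical_set_scope.
Local Open Scope ring_scope.

(* A Banach space whose norm comes from a real inner product; [{dot H for idfun}]
   is the type of symmetric positive definite bilinear forms on [H]. *)
HB.mixin Record isHilbert (R : realType) H of CompleteNormedModule R H := {
  hdot : {dot H for idfun};
  hdotxx : forall x : H, hdot x x = `|x| ^+ 2
}.

#[short(type="hilbertType")]
HB.structure Definition Hilbert (R : realType) :=
  {H of isHilbert R H & CompleteNormedModule R H}.

Arguments hdot {R H} : rename.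

Notation "'<< x , y >>" := (hdot x y)
  (at level 0, x, y at level 99, format "''<<' x ,  y >>") : ring_scope.

Section Convexity.
Context {R : realType} {H : hilbertType R}.

Definition has_convexity_constant (c : R) (f : H -> R) : Prop :=
  @convex_function R H setT (fun x : H => f x - c / 2 * `|x| ^+ 2).

(* In [\bar R], [0 * +oo = 0], so the endpoints [t = 0, 1] are harmless. *)
Definition econvex (F : H -> \bar R) : Prop :=
  forall (x y : H) (t : R), 0 <= t <= 1 ->
    (F (t *: x + (1 - t) *: y)%R <= t%:E * F x + (1 - t)%:E * F y)%E.

Definition proper_fun (F : H -> \bar R) : Prop :=
  (forall x, F x != -oo%E) /\ (exists x, F x != +oo%E).

Definition fenchel_conjugate (F : H -> \bar R) (y : H) : \bar R :=
  ereal_sup [set ('<< y, x >>%:E - F x)%E | x in [set: H]].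

End Convexity.

Section Calculus.
Context {R : realType}.

Definition bounded_operator (X Y : hilbertType R) (K : {linear X -> Y}) : Prop :=
  exists M : R, forall x, `|K x| <= M * `|x|.

Definition is_adjoint (X Y : hilbertType R) (K : X -> Y) (Ks : Y -> X) : Prop :=
  forall x y, '<< K x, y >> = '<< x, Ks y >>.

Definition is_gradient (H : hilbertType R) (f : H -> R) (g : H -> H) : Prop :=
  forall x, differentiable f x /\ forall h, 'd f x h = '<< g x, h >>.

(* Twice continuously Frechet differentiable. The second derivative at [x] is
   the bounded bilinear form [D2 x]: it is the derivative of [x |-> 'd f x] in
   the operator norm of continuous linear forms, and it depends continuously on
   [x] in the norm of bounded bilinear forms. Both norms are written out, as
   bounds uniform in the arguments of the forms. *)
Definition twice_continuously_differentiable (V : normedModType R)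
    (f : V -> R) : Prop :=
  (forall x, differentiable f x) /\
  exists D2 : V -> {biscalar V},
  [/\ forall x, exists M : R, forall k h, `|D2 x k h| <= M * `|k| * `|h|,
      forall (x : V) (e : R), 0 < e -> \forall k \near (0 : V), forall h,
        `|'d f (x + k) h - 'd f x h - D2 x k h| <= e * `|k| * `|h|
    & forall (x : V) (e : R), 0 < e -> \forall z \near x, forall k h,
        `|D2 z k h - D2 x k h| <= e * `|k| * `|h| ].

End Calculus.

(* Derivatives of curves on [0, +oo[: the difference quotients at [t] range
   over the points [u != t] of [0, +oo[, so this is the usual derivative at
   [t > 0] and the right derivative at [0]. Values at negative times are
   irrelevant. *)
Section HalfLine.
Context {R : realType} {V : normedModType R}.

Definition halfline_quotient (f : R -> V) (t : R) : set_system V :=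
  (u - t)^-1 *: (f u - f t) @[u --> within `[0, +oo[ t^'].

Definition derivable_halfline (f : R -> V) : Prop :=
  forall t : R, 0 <= t -> cvg (halfline_quotient f t).

Definition derive_halfline (f : R -> V) (t : R) : V :=
  lim (halfline_quotient f t).

End HalfLine.

Local Notation D := derive_halfline.

Section Systems.
Context {R : realType} {X Y : hilbertType R}.
Variables (K : X -> Y) (Ks : Y -> X) (gradG : X -> X) (gradFs : Y -> Y).
Variables (gamma rho : R).

Record derivable_curves (phi psi theta : R -> R)
    (x : R -> X) (y : R -> Y) (zeta : R -> X) (eta : R -> Y) : Prop := {
  derivable_phi : derivable_halfline (phi : R -> R^o);
  derivable_psi : derivable_halfline (psi : R -> R^o);
  derivable_theta : derivable_halfline (theta : R -> R^o);
  derivable_x : derivable_halfline x;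
  derivable_y : derivable_halfline y;
  derivable_zeta : derivable_halfline zeta;
  derivable_eta : derivable_halfline eta
}.

Definition positive_halfline (f : R -> R) : Prop := forall t, 0 <= t -> 0 < f t.

Record solves_system_t (phi psi theta : R -> R)
    (x : R -> X) (y : R -> Y) (zeta : R -> X) (eta : R -> Y) : Prop := {
  systt_derivable : derivable_curves phi psi theta x y zeta eta;
  systt_phi_gt0 : positive_halfline phi;
  systt_psi_gt0 : positive_halfline psi;
  systt_theta_gt0 : positive_halfline theta;
  systt_phi : forall t, 0 <= t ->
    D (phi : R -> R^o) t = 2 * gamma * theta t;
  systt_psi : forall t, 0 <= t ->
    D (psi : R -> R^o) t = 2 * rho * theta t;
  systt_theta : forall t, 0 <= t ->
    D (theta : R -> R^o) t = theta t;
  systt_x : forall t, 0 <= t -> D x t = zeta t - x t;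
  systt_y : forall t, 0 <= t -> D y t = eta t - y t;
  systt_zeta : forall t, 0 <= t ->
    phi t *: D zeta t =
      theta t *: (gamma *: (x t - zeta t) - gradG (x t) - Ks (eta t));
  systt_eta : forall t, 0 <= t ->
    psi t *: D eta t =
      theta t *: (rho *: (y t - eta t) - gradFs (y t) + K (zeta t))
}.

Record solves_system_s (phi psi theta : R -> R)
    (x : R -> X) (y : R -> Y) (zeta : R -> X) (eta : R -> Y) : Prop := {
  systs_derivable : derivable_curves phi psi theta x y zeta eta;
  systs_phi_gt0 : positive_halfline phi;
  systs_psi_gt0 : positive_halfline psi;
  systs_theta_gt0 : positive_halfline theta;
  systs_phi : forall s, 0 <= s ->
    D (phi : R -> R^o) s = 2 * gamma * Num.sqrt (phi s * psi s);
  systs_psi : forall s, 0 <= s ->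
    D (psi : R -> R^o) s = 2 * rho * Num.sqrt (phi s * psi s);
  systs_theta : forall s, 0 <= s ->
    D (theta : R -> R^o) s = Num.sqrt (phi s * psi s);
  systs_x : forall s, 0 <= s ->
    theta s *: D x s = (D (theta : R -> R^o) s : R) *: (zeta s - x s);
  systs_y : forall s, 0 <= s ->
    theta s *: D y s = (D (theta : R -> R^o) s : R) *: (eta s - y s);
  systs_zeta : forall s, 0 <= s ->
    Num.sqrt (phi s) *: D zeta s =
      Num.sqrt (psi s) *: (gamma *: (x s - zeta s) - gradG (x s) - Ks (eta s));
  systs_eta : forall s, 0 <= s ->
    Num.sqrt (psi s) *: D eta s =
      Num.sqrt (phi s) *: (rho *: (y s - eta s) - gradFs (y s) + K (zeta s))
}.

End Systems.

(* Main.v *)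
(* Both systems integrate explicitly in the scalar unknowns: phi - 2 gamma theta
   and psi - 2 rho theta are constant, likewise for phi', psi', theta', and theta
   is exponential, so that theta (t s) = theta' s and hence phi (t s) = phi' s and
   psi (t s) = psi' s.
   With the scalars known, (x, y, zeta, eta) o t and (x', y', zeta', eta') solve the
   same non-autonomous equation. Its right-hand side is locally Lipschitz (the
   gradients because they come from C^2 functions), so Gronwall's inequality
   applied to the sum of the squared norms of the differences gives equality. *)

Require Import Defs.
From mathcomp Require Import all_boot all_order all_algebra.
From mathcomp Require Import all_classical all_reals all_analysis.
From mathcomp Require Import ring lra.

Import Order.TTheory GRing.Theory Num.Theory.
Import numFieldNormedType.Exports.

Local Open Scope classical_set_scope.
Local Open Scope ring_scope.

(** * The inner product and Cauchy-Schwarz *)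

Section Hdot.
Context {R : realType} {H : hilbertType R}.
Implicit Types a b c : H.

Lemma hdotC a b : '<< a, b >> = '<< b, a >>.
Proof. by rewrite hermC expr0 mul1r. Qed.

Lemma hdotDr a b c : '<< a, b + c >> = '<< a, b >> + '<< a, c >>.
Proof. exact: linearDr. Qed.

Lemma hdotBr a b c : '<< a, b - c >> = '<< a, b >> - '<< a, c >>.
Proof. exact: linearBr. Qed.

Lemma hdotZr a (k : R) b : '<< a, k *: b >> = k * '<< a, b >>.
Proof. exact: linearZr_LR. Qed.

Lemma hdotBl a b c : '<< a - b, c >> = '<< a, c >> - '<< b, c >>.
Proof. exact: linearBl. Qed.

Lemma normD_hdot a b : `|a + b| ^+ 2 = `|a| ^+ 2 + 2 * '<< a, b >> + `|b| ^+ 2.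
Proof.
rewrite -!hdotxx hdotDr (hdotC (a + b) a) (hdotC (a + b) b) !hdotDr (hdotC b a); ring.
Qed.

(** Cauchy-Schwarz is obtained by squaring the triangle inequality, which the norm already
    satisfies, and cancelling the squares. *)
Lemma hdot_le a b : '<< a, b >> <= `|a| * `|b|.
Proof.
have : `|a + b| ^+ 2 <= (`|a| + `|b|) ^+ 2.
  by rewrite lerXn2r ?nnegrE ?addr_ge0 ?ler_normD.
rewrite normD_hdot sqrrD.
set p := `|a|; set q := `|b|; set d := '<< _, _ >>; lra.
Qed.

End Hdot.

(** * Differential calculus of curves in normed spaces *)

Section CurveDerivatives.
Context {R : realType}.

(** On the real line the directional quotient in direction [1] is the ordinary difference quotient.
    This lemma and the next pass between the two. *)
Lemma is_derive_of_cvg {V : normedModType R} {f : R -> V} {t : R} {l : V} :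
  h^-1 *: (f (h + t) - f t) @[h --> (0 : R)^'] --> l ->
  is_derive t (1 : R) f l.
Proof.
move=> fl.
have E : (fun h : R => h^-1 *: ((f \o shift t) (h *: (1 : R)) - f t)) =
         (fun h : R => h^-1 *: (f (h + t) - f t)).
  by apply/funext => h /=; rewrite /shift /= [h *: _]mulr1.
split; last by rewrite /derive E; exact: cvg_lim.
by rewrite /derivable E; apply/cvg_ex; exists l.
Qed.

Lemma cvg_of_is_derive {V : normedModType R} {f : R -> V} {t : R} {l : V} :
  is_derive t (1 : R) f l ->
  h^-1 *: (f (h + t) - f t) @[h --> (0 : R)^'] --> l.
Proof.
move=> [+ <-]; rewrite /derivable /derive.
have -> : (fun h : R => h^-1 *: ((f \o shift t) (h *: (1 : R)) - f t)) =
         (fun h : R => h^-1 *: (f (h + t) - f t)).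
  by apply/funext => h /=; rewrite /shift /= [h *: _]mulr1.
by [].
Qed.

Lemma is_derive_continuous {V : normedModType R} {f : R -> V} {t : R} {l : V} :
  is_derive t (1 : R) f l -> f r @[r --> t] --> f t.
Proof.
by move=> [/derivable1_diffP/differentiable_continuous + _].
Qed.

Lemma is_derive_comp {V : normedModType R} {f : R -> V} {g : R -> R} {t dg : R} {l : V} :
  is_derive (g t) (1 : R) f l -> is_derive t (1 : R) g dg ->
  is_derive t (1 : R) (f \o g) (dg *: l).
Proof.
move=> [df fl] [dg' gl].
have Df : differentiable f (g t) by apply/derivable1_diffP.
have Dg : differentiable g t by apply/derivable1_diffP.
have Dfg : differentiable (f \o g) t by exact: differentiable_comp.
split; first by apply/derivable1_diffP.
have Eg : 'd g t 1 = dg by rewrite -gl deriveE.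
rewrite deriveE // diff_comp //= [X in _ X = _]Eg -fl deriveE //.
by rewrite -linearZ /= [_ *: _]mulr1.
Qed.

Lemma is_derive_sqnorm {H : hilbertType R} {u : R -> H} {t : R} {du : H} :
  is_derive t (1 : R) u du ->
  is_derive t (1 : R) (fun r => `|u r| ^+ 2) (2 * '<< du, u t >>).
Proof.
move=> Du.
(* The value is ['<< du, u t + u t >>] in polarized form, which is the shape in which the limit of
   the quotients will appear. *)
have E : 2 * '<< du, u t >> =
    2^-1 * (`|du + (u t + u t)| ^+ 2 - `|du| ^+ 2 - `|u t + u t| ^+ 2).
  by rewrite normD_hdot hdotDr; field.
apply: (is_derive_eq _ (esym E)); apply: is_derive_of_cvg.
have hq := cvg_of_is_derive Du.
have hc : u (h + t) @[h --> (0 : R)^'] --> u t.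
  apply: cvg_within_filter.
  have hs : h + t @[h --> (0 : R)] --> t.
    rewrite -[X in _ --> X](add0r t).
    by apply: cvgD; [exact: cvg_id|exact: cvg_cst].
  exact: (cvg_comp _ _ hs (is_derive_continuous Du)).
(* Polarization reduces continuity of the inner product to that of the norm. *)
have -> : (fun h : R => h^-1 *: (`|u (h + t)| ^+ 2 - `|u t| ^+ 2)) =
  (fun h : R => 2^-1 * (`|h^-1 *: (u (h + t) - u t) + (u (h + t) + u t)| ^+ 2
      - `|h^-1 *: (u (h + t) - u t)| ^+ 2 - `|u (h + t) + u t| ^+ 2)).
  apply/funext => h.
  transitivity (h^-1 * (`|u (h + t)| ^+ 2 - `|u t| ^+ 2)); first by [].
  rewrite (normD_hdot (h^-1 *: _)) (hdotC (h^-1 *: _)) hdotZr hdotBr.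
  rewrite (hdotC (_ + _) (u (h + t))) (hdotC (_ + _) (u t)) !hdotDr.
  rewrite (hdotC (u t) (u (h + t))) !hdotxx; move: h^-1 => k; field => //.
have hs : u (h + t) + u t @[h --> (0 : R)^'] --> u t + u t.
  exact: cvgD hc (cvg_cst (u t)).
have N2 (f : R -> H) l : f h @[h --> (0 : R)^'] --> l ->
    (`|f h| ^+ 2) @[h --> (0 : R)^'] --> `|l| ^+ 2.
  by move=> fl; rewrite !expr2; apply: cvgM; apply: cvg_norm.
exact: (cvgM (cvg_cst _) (cvgB (cvgB (N2 _ _ (cvgD hq hs)) (N2 _ _ hq)) (N2 _ _ hs))).
Qed.
End CurveDerivatives.

(** * From one-sided to two-sided derivatives *)

Section HalfLineExtension.
Context {R : realType} {V : normedModType R}.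

(* Continuing a curve affinely to negative times turns one-sided derivatives at 0
   into two-sided ones, so that the calculus of [is_derive] applies. *)
Definition halfline_extension (f : R -> V) (t : R) : V :=
  if 0 <= t then f t else f 0 + t *: derive_halfline f 0.

Lemma halfline_extensionE (f : R -> V) (t : R) :
  0 <= t -> halfline_extension f t = f t.
Proof. by rewrite /halfline_extension => ->. Qed.

(** At [t > 0] the extension agrees with [f] near [t]. At [0] the quotients from the left are those
    of an affine map of slope [derive_halfline f 0], so they equal the limit exactly. *)
Lemma is_derive_halfline_extension (f : R -> V) (t : R) :
  derivable_halfline f -> 0 <= t ->
  is_derive t (1 : R) (halfline_extension f) (derive_halfline f t).
Proof.
move=> df t0; apply: is_derive_of_cvg; apply/cvgrPdist_lt => e e0.
have /cvgrPdist_lt/(_ e e0) := df t t0.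
rewrite -/(derive_halfline f t) => H.
have {}H : \forall u \near t, u != t -> 0 <= u ->
    `|derive_halfline f t - (u - t)^-1 *: (f u - f t)| < e.
  move: H; rewrite /dnbhs near_withinE near_withinE.
  apply: filterS => u Hu ut u0; apply: Hu => //=.
  by rewrite in_itv /= u0.
have {}H : \forall h \near (0 : R), h != 0 -> 0 <= h + t ->
    `|derive_halfline f t - h^-1 *: (f (h + t) - f t)| < e.
  have hs : h + t @[h --> (0 : R)] --> t.
    rewrite -[X in _ --> X](add0r t).
    by apply: cvgD; [exact: cvg_id|exact: cvg_cst].
  have := hs _ H; apply: (@filterS _ (nbhs (0 : R))) => h /= + h0 ht.
  by rewrite -(subr_eq0 (h + t)) addrK; apply.
have H' : t = 0 \/ \forall h \near (0 : R), 0 <= h + t.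
  case: (eqVneq t 0) => [->|tn0]; [by left|right].
  have tp : 0 < t by rewrite lt_def tn0.
  have := @nbhs0_lt R R t tp; apply: filterS => h.
  by rewrite ltr_norml => /andP[]; lra.
rewrite near_withinE.
case: H' => [t_eq0|H'].
  subst t; move: H; apply: filterS => h Hh h0.
  rewrite /halfline_extension addr0 lexx.
  move: Hh; rewrite addr0; case: (leP 0 h) => [h1|h1 _]; first exact.
  by rewrite [f 0 + _]addrC addrK scalerA mulVf// scale1r subrr normr0.
move: H H'; apply: filterS2 => h Hh ht h0.
by rewrite /halfline_extension t0 ht; exact: Hh.
Qed.

End HalfLineExtension.

(** * Continuous induction and a local Gronwall argument *)

Section LocalGronwall.
Context {R : realType}.

(** Continuous induction: let [m] be the supremum of the [s <= r] such that [E] vanishes on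
    [[0, s]]. Continuity gives [E m = 0], and the local hypothesis would push past [m] unless
    [m = r]. *)
Lemma halfline_vanish (E : R -> R) :
  (forall s : R, 0 <= s -> E r @[r --> s] --> E s) ->
  E 0 = 0 ->
  (forall s : R, 0 <= s -> E s = 0 ->
    exists2 d, 0 < d & forall r, s <= r <= s + d -> E r = 0) ->
  forall s : R, 0 <= s -> E s = 0.
Proof.
move=> Ec E0 Eloc r r0.
pose A := [set s | 0 <= s <= r /\ forall u, 0 <= u <= s -> E u = 0].
have A0 : A 0.
  split; first by rewrite lexx r0.
  by move=> u; rewrite -eq_le => /eqP <-.
have Aub : ubound A r by move=> s [/andP[]].
have Asup : has_sup A by split; [exists 0|exists r].
set m := sup A.
have m0 : 0 <= m by apply: ub_le_sup => //; exists r.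
have mr : m <= r by apply: ge_sup => //; exists 0.
have Elt u : 0 <= u -> u < m -> E u = 0.
  move=> u0 um.
  have [s [_ sA] us] : exists2 s, A s & u < s.
    have [|s sA us] := @sup_adherent _ A (m - u) _ Asup; first by rewrite subr_gt0.
    by exists s => //; move: us; rewrite -/m; lra.
  by apply: sA; rewrite u0 ltW.
have Em : E m = 0.
  have [m_eq|mn0] := eqVneq m 0; first by rewrite m_eq.
  apply/eqP; apply: contraT => Em0.
  have mp : 0 < m by rewrite lt_def mn0.
  have : \forall u \near m, E u != 0.
    exact: cvgr_neq0 (Ec m m0) Em0.
  case/nbhs_ballP => e /= e0 He.
  (* The point [m - d] is nonnegative, strictly below [m], and within [e] of [m]: there [E] would be
     both zero and nonzero. *)
  pose d := Num.min (e / 2) m.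
  have d0 : 0 < d by rewrite lt_min mp divr_gt0.
  have dm : d <= m by rewrite ge_min lexx orbT.
  have de : d < e by rewrite gt_min; apply/orP; left; lra.
  have := He (m - d); rewrite /ball /= opprB addrC subrK gtr0_norm // => /(_ de).
  by rewrite Elt ?eqxx //; lra.
have [d d0 Hd] := Eloc m m0 Em.
have [<-//|mr'] := eqVneq m r.
have mltr : m < r by rewrite lt_def eq_sym mr'.
pose d' := Num.min d (r - m).
have d'0 : 0 < d' by rewrite lt_min d0 subr_gt0.
have d'd : d' <= d by rewrite ge_min lexx.
have d'r : d' <= r - m by rewrite ge_min lexx orbT.
suff /(ub_le_sup (ex_intro _ r Aub)) : A (m + d') by rewrite -/m; lra.
split; first lra.
move=> u /andP[u0 ud]; case: (ltP u m) => um; first exact: Elt.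
by apply: Hd; lra.
Qed.

(** The constant [C] may depend on the zero [s] of [E], which suits vector fields that are only
    locally Lipschitz. To the right of such an [s], the integrating factor [expR (- C * u)] makes
    [E] nonincreasing, hence nonpositive, hence zero; continuous induction does the rest. *)
Lemma local_gronwall (E dE : R -> R) :
  (forall s : R, 0 <= s -> is_derive s (1 : R) E (dE s)) ->
  (forall s : R, 0 <= E s) -> E 0 = 0 ->
  (forall s : R, 0 <= s -> E s = 0 ->
    exists C, \forall r \near s, 0 <= r -> dE r <= C * E r) ->
  forall s : R, 0 <= s -> E s = 0.
Proof.
move=> ED Ege0 E0 Eloc; apply: halfline_vanish => // [s s0|s s0 Es].
  exact: is_derive_continuous (ED s s0).
have [C /nbhs_ballP[e /= e0 HC]] := Eloc s s0 Es.
exists (e / 2); first by rewrite divr_gt0.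
move=> r /andP[sr re].
have HCs u : s <= u <= r -> dE u <= C * E u.
  move=> /andP[su ur]; apply: HC; last lra.
  rewrite /ball /= ler0_norm ?opprB; lra.
pose g u := expR (- C * u) * E u.
pose dg u := expR (- C * u) * (dE u - C * E u).
have gD u : s <= u -> is_derive u (1 : R) g (dg u).
  move=> su.
  have D1 : is_derive u (1 : R) (fun u => - C * u) (- C).
    have := @is_deriveZ R R R id (- C) u 1 1 (is_derive_id u (1 : R)).
    by move/is_derive_eq; apply; rewrite [LHS]mulr1.
  have D2 := is_derive1_comp (is_derive_expR (- C * u)) D1.
  have D3 := is_deriveM D2 (ED u (le_trans s0 su)).
  apply: (is_derive_eq D3); rewrite /dg /=.
  rewrite /GRing.scale /=; ring.
have [<-//|sr'] := eqVneq s r.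
have sltr : s < r by rewrite lt_def eq_sym sr'.
have gI c : c \in `]s, r[ -> is_derive c (1 : R) g (dg c).
  by rewrite in_itv /= => /andP[sc _]; apply: gD; exact: ltW.
have gc : {within `[s, r], continuous g}.
  apply: derivable_within_continuous => c.
  by rewrite in_itv /= => /andP[sc _]; have [] := gD c sc.
have [c cI] := MVT sltr gI gc.
rewrite {2}/g Es mulr0 subr0 => Egr.
move: cI; rewrite in_itv /= => /andP[sc cr].
have gr0 : g r <= 0.
  rewrite Egr; apply: mulr_le0_ge0; last by rewrite subr_ge0 ltW.
  rewrite /dg pmulr_rle0 ?expR_gt0 // subr_le0; apply: HCs; lra.
apply/eqP; rewrite eq_le Ege0 andbT.
by move: gr0; rewrite /g pmulr_rle0 ?expR_gt0.
Qed.

End LocalGronwall.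

(** * Local Lipschitz bounds for gradients and for the adjoint *)

Section LocallyLipschitz.
Context {R : realType}.

Definition locally_lipschitz {V W : normedModType R} (g : V -> W) : Prop :=
  forall x : V, exists2 L, 0 <= L &
    exists2 r, 0 < r & forall p q : V, `|x - p| < r -> `|x - q| < r ->
      `|g p - g q| <= L * `|p - q|.

(* The mean value theorem is applied to ['d f _ h] for each fixed [h], so that no
   vector-valued mean value inequality is needed. *)
Lemma C2_differential_locally_lipschitz {V : normedModType R} {f : V -> R} :
  twice_continuously_differentiable f ->
  forall x : V, exists2 L, 0 <= L &
    exists2 r, 0 < r & forall p q h : V, `|x - p| < r -> `|x - q| < r ->
      `|'d f p h - 'd f q h| <= L * `|p - q| * `|h|.
Proof.
move=> [df [D2 [D2b D2d D2c]]] x.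
have [M HM] := D2b x.
have /nbhs_ballP[r /= r0 Hr] := D2c x 1 ltr01.
(* [M] bounds the second derivative at [x], and on the ball of radius [r] it moves by at most
   [1]. *)
exists (`|M| + 1); first by rewrite addr_ge0.
exists r => // p q h xp xq.
have D2le z : `|x - z| < r -> forall k, `|D2 z k h| <= (`|M| + 1) * `|k| * `|h|.
  move=> xz k.
  have H1 : `|D2 z k h - D2 x k h| <= 1 * `|k| * `|h|.
    by apply: Hr; rewrite -ball_normE.
  have H2 := HM k h.
  have H3 : M * `|k| * `|h| <= `|M| * `|k| * `|h|.
    by rewrite ler_wpM2r // ler_wpM2r // ler_norm.
  have := ler_normD (D2 z k h - D2 x k h) (D2 x k h); rewrite subrK; lra.
set w := p - q.
pose c (u : R) : V := q + u *: w.
pose F u := 'd f (c u) h.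
have cE u v : c (v + u) = c u + v *: w.
  by rewrite /c scalerDl addrCA addrC -addrA.
have FD u : is_derive u (1 : R) F (D2 (c u) w h).
  apply: is_derive_of_cvg; apply/cvgrPdist_lt => e e0.
  (* The error allowed by [D2d] is [e1 * |v| * |w| * |h|]. Adding [1] to each norm avoids dividing
     by zero and makes this strictly less than [e * |v|]. *)
  pose e1 := e / ((`|w| + 1) * (`|h| + 1)).
  have W0 : 0 < `|w| + 1 by rewrite ltr_wpDl.
  have H0 : 0 < `|h| + 1 by rewrite ltr_wpDl.
  have e10 : 0 < e1 by rewrite divr_gt0 ?mulr_gt0.
  have /nbhs_ballP[d /= d0 Hd] := D2d (c u) e1 e10.
  rewrite near_withinE; apply/nbhs_ballP.
  exists (d / (`|w| + 1)); first by rewrite /= divr_gt0.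
  move=> v; rewrite -ball_normE /= sub0r normrN ltr_pdivlMr // => vd v0.
  have vw : ball (0 : V) d (v *: w).
    rewrite -ball_normE /= sub0r normrN normrZ.
    by apply: le_lt_trans vd; rewrite ler_wpM2l // ler_wpDr.
  have := Hd _ vw h.
  rewrite linearZl_LR /= normrZ /F cE => Hv.
  set A := 'd f _ h in Hv *; set B := 'd f _ h in Hv *; set Q := D2 _ _ _ in Hv *.
  have -> : Q - v^-1 *: (A - B) = - (v^-1 * (A - B - v * Q)).
    have Esc : v^-1 *: (A - B) = v^-1 * (A - B) by [].
    by rewrite Esc [in RHS]mulrBr mulKf // opprB.
  rewrite normrN normrM normfV ltr_pdivrMl ?normr_gt0 //.
  apply: le_lt_trans Hv _.
  have -> : e = e1 * ((`|w| + 1) * (`|h| + 1)).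
    by rewrite divfK // gt_eqF // mulr_gt0.
  rewrite -subr_gt0.
  have -> : `|v| * (e1 * ((`|w| + 1) * (`|h| + 1))) - e1 * (`|v| * `|w|) * `|h| =
            `|v| * e1 * (`|w| + `|h| + 1) by ring.
  by rewrite !mulr_gt0 ?normr_gt0 // ltr_wpDl ?addr_ge0.
have FI (u : R) : u \in `]0, 1[ -> is_derive u (1 : R) F (D2 (c u) w h) by [].
have Fc : {within `[0, 1], continuous F}.
  by apply: derivable_within_continuous => u _; have [] := FD u.
have [u] := MVT ltr01 FI Fc.
rewrite in_itv /= subr0 mulr1 => /andP[u0 u1].
have qw : q + w = p by rewrite /w addrC subrK.
rewrite /F /c scale1r scale0r addr0 qw => ->.
apply: D2le; rewrite /w.
(* Balls are convex, so the intermediate point of the segment stays where the bound on [D2]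
   holds. *)
have -> : x - (q + u *: (p - q)) = u *: (x - p) + (1 - u) *: (x - q).
  have -> : p - q = - (x - p - (x - q)) by rewrite !opprB [RHS]addrC addrA subrK.
  by rewrite scalerN scalerBr scalerBl scale1r opprD opprK addrA addrCA.
apply: le_lt_trans (ler_normD _ _) _.
rewrite !normrZ !gtr0_norm ?subr_gt0 //.
have -> : r = u * r + (1 - u) * r by ring.
by apply: ltrD; rewrite ltr_pM2l ?subr_gt0.
Qed.

(** Testing the bound on differentials against [v = g p - g q] itself gives
    [|v|^2 <= L * |p - q| * |v|], and [|v|] cancels. *)
Lemma gradient_locally_lipschitz {H : hilbertType R} {f : H -> R} {g : H -> H} :
  twice_continuously_differentiable f -> is_gradient f g -> locally_lipschitz g.
Proof.
move=> fC2 fg x.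
have [L L0 [r r0 HL]] := C2_differential_locally_lipschitz fC2 x.
exists L => //; exists r => // p q xp xq.
set v := g p - g q.
have := HL p q v xp xq; rewrite !(proj2 (fg _)) -hdotBl -/v hdotxx.
rewrite ger0_norm ?exprn_ge0 // expr2.
have [->|v0] := eqVneq v 0; first by rewrite normr0 mulr_ge0.
by rewrite ler_pM2r // normr_gt0.
Qed.

(** With [v = Ks a - Ks b], the adjoint identity gives [|v|^2 = '<< K v, a - b >>]; Cauchy-Schwarz
    and the bound on [K] then let [|v|] cancel. *)
Lemma adjoint_lipschitz {X Y : hilbertType R} {K : {linear X -> Y}} {Ks : Y -> X} :
  bounded_operator K -> is_adjoint K Ks ->
  exists2 M, 0 <= M & (forall a, `|K a| <= M * `|a|) /\
    forall a b, `|Ks a - Ks b| <= M * `|a - b|.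
Proof.
move=> [M HM] KKs; exists `|M| => //.
have KM a : `|K a| <= `|M| * `|a|.
  by apply: le_trans (HM a) _; rewrite ler_wpM2r // ler_norm.
split => // a b; set v := Ks a - Ks b.
have [->|v0] := eqVneq v 0; first by rewrite normr0 mulr_ge0.
rewrite -(@ler_pM2r _ `|v|) ?normr_gt0 //.
rewrite -expr2 -hdotxx {2}/v hdotBr -!KKs -hdotBr.
apply: le_trans (hdot_le _ _) _.
rewrite mulrAC; apply: ler_wpM2r => //.
Qed.

End LocallyLipschitz.

(** * Uniqueness for the non-autonomous system with prescribed rates *)

Lemma subrACA {V : zmodType} (p q m n : V) : (p - q) - (m - n) = (p - m) - (q - n).
Proof. by rewrite opprD addrACA -opprD. Qed.

(** This brings the four velocity differences under one constant. The coefficients [g'] and [l'],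
    absent on the left, pad the right-hand side so that it also covers the dual components. *)
Lemma rate_le {R : realDomainType} (A g l k g' l' N t u v w : R) :
  0 <= A -> 0 <= g -> 0 <= l -> 0 <= k -> 0 <= g' -> 0 <= l' -> 0 <= N ->
  t <= N -> u <= N -> v <= N -> w <= N ->
  A * (t + g * u + l * v + k * w) <= A * (1 + g + g' + l + l' + k) * N.
Proof.
move=> A0 g0 l0 k0 g'0 l'0 N0 tN uN vN wN; rewrite -mulrA ler_wpM2l //.
rewrite !mulrDl mul1r; apply: lerD; last exact: ler_wpM2l.
apply: ler_wpDr; first exact: mulr_ge0.
apply: lerD; last exact: ler_wpM2l.
apply: ler_wpDr; first exact: mulr_ge0.
by apply: lerD => //; exact: ler_wpM2l.
Qed.

(** The gap is the sum of the six squared pairwise differences. It turns the square of a sum of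
    distances back into the energy. *)
Lemma sqr_sum4 {R : realDomainType} (p q m n : R) :
  (p + q + m + n) ^+ 2 <= 4 * (p ^+ 2 + q ^+ 2 + m ^+ 2 + n ^+ 2).
Proof.
rewrite -subr_ge0.
have -> : 4 * (p ^+ 2 + q ^+ 2 + m ^+ 2 + n ^+ 2) - (p + q + m + n) ^+ 2 =
  (p - q) ^+ 2 + (p - m) ^+ 2 + (p - n) ^+ 2 + (q - m) ^+ 2 + (q - n) ^+ 2 + (m - n) ^+ 2.
  by ring.
by rewrite !addr_ge0 ?sqr_ge0.
Qed.

Lemma le_sum4 {R : realDomainType} {p q m n : R} :
  0 <= p -> 0 <= q -> 0 <= m -> 0 <= n ->
  (p + m <= p + q + m + n /\ q + n <= p + q + m + n) /\
  [/\ p <= p + q + m + n, q <= p + q + m + n, m <= p + q + m + n & n <= p + q + m + n].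
Proof. by move=> *; split; split; lra. Qed.

Section Uniqueness.
Context {R : realType} {X Y : hilbertType R}.
Variables (K : {linear X -> Y}) (Ks : Y -> X) (gradG : X -> X) (gradFs : Y -> Y).
Variables (gamma rho : R) (a b c : R -> R).

(** The common form of both systems once the scalar unknowns are known: [a], [b], [c] are their
    quotients, regarded as given functions of time. *)
Definition rescaled_flow (x : R -> X) (y : R -> Y) (z : R -> X) (e : R -> Y) :=
  forall s : R, 0 <= s ->
  [/\ is_derive s (1 : R) x (a s *: (z s - x s)),
      is_derive s (1 : R) y (a s *: (e s - y s)),
      is_derive s (1 : R) z
        (b s *: (gamma *: (x s - z s) - gradG (x s) - Ks (e s))) &
      is_derive s (1 : R) e
        (c s *: (rho *: (y s - e s) - gradFs (y s) + K (z s)))].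

(** Local Gronwall is applied to the energy [E]. It asks for an estimate only near times where the
    solutions coincide; there continuity keeps both in one ball on which the gradients are
    Lipschitz. *)
Lemma rescaled_flow_unique x1 y1 z1 e1 x2 y2 z2 e2 :
  bounded_operator K -> is_adjoint K Ks ->
  locally_lipschitz gradG -> locally_lipschitz gradFs ->
  (forall s : R, 0 <= s ->
    [/\ a r @[r --> s] --> a s, b r @[r --> s] --> b s & c r @[r --> s] --> c s]) ->
  rescaled_flow x1 y1 z1 e1 -> rescaled_flow x2 y2 z2 e2 ->
  x1 0 = x2 0 -> y1 0 = y2 0 -> z1 0 = z2 0 -> e1 0 = e2 0 ->
  forall s : R, 0 <= s ->
    [/\ x1 s = x2 s, y1 s = y2 s, z1 s = z2 s & e1 s = e2 s].
Proof.
move=> Kb Kadj LG LF abc f1 f2 x0 y0 z0 e0.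
pose E (s : R) := `|x1 s - x2 s| ^+ 2 + `|y1 s - y2 s| ^+ 2 +
            `|z1 s - z2 s| ^+ 2 + `|e1 s - e2 s| ^+ 2.
have [M M0 [KM KsM]] := adjoint_lipschitz Kb Kadj.
pose dx (s : R) := a s *: (z1 s - x1 s) - a s *: (z2 s - x2 s).
pose dy (s : R) := a s *: (e1 s - y1 s) - a s *: (e2 s - y2 s).
pose dz (s : R) := b s *: (gamma *: (x1 s - z1 s) - gradG (x1 s) - Ks (e1 s)) -
           b s *: (gamma *: (x2 s - z2 s) - gradG (x2 s) - Ks (e2 s)).
pose de (s : R) := c s *: (rho *: (y1 s - e1 s) - gradFs (y1 s) + K (z1 s)) -
           c s *: (rho *: (y2 s - e2 s) - gradFs (y2 s) + K (z2 s)).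
pose dE (s : R) := 2 * '<< dx s, x1 s - x2 s >> + 2 * '<< dy s, y1 s - y2 s >> +
           2 * '<< dz s, z1 s - z2 s >> + 2 * '<< de s, e1 s - e2 s >>.
have ED (s : R) : 0 <= s -> is_derive s (1 : R) E (dE s).
  move=> s0; have [X1 Y1 Z1 E1] := f1 s s0; have [X2 Y2 Z2 E2] := f2 s s0.
  exact: is_deriveD (is_deriveD (is_deriveD (is_derive_sqnorm (is_deriveB X1 X2))
    (is_derive_sqnorm (is_deriveB Y1 Y2))) (is_derive_sqnorm (is_deriveB Z1 Z2)))
    (is_derive_sqnorm (is_deriveB E1 E2)).
have E0 : E 0 = 0 by rewrite /E x0 y0 z0 e0 !subrr !normr0 expr0n /= !addr0.
have Ege0 s : 0 <= E s by rewrite !addr_ge0.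
have EE s : E s = 0 -> [/\ x1 s = x2 s, y1 s = y2 s, z1 s = z2 s & e1 s = e2 s].
  move=> /eqP; rewrite !paddr_eq0 ?addr_ge0 // !sqrf_eq0 !normr_eq0 !subr_eq0.
  by move=> /andP[/andP[/andP[/eqP-> /eqP->] /eqP->] /eqP->].
suff EZ (s : R) : 0 <= s -> E s = 0 by move=> s s0; exact: EE (EZ s s0).
move: s; apply: (local_gronwall _ _ ED Ege0 E0).
move=> s s0 /EE[xs ys zs es].
have [LG' LG0 [rG rG0 HG]] := LG (x1 s).
have [LF' LF0 [rF rF0 HF]] := LF (y1 s).
have [ac bc cc] := abc s s0.
have [X1 Y1 _ _] := f1 s s0; have [X2 Y2 _ _] := f2 s s0.
have {}X1 := is_derive_continuous X1; have {}Y1 := is_derive_continuous Y1.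
have {}X2 := is_derive_continuous X2; have {}Y2 := is_derive_continuous Y2.
rewrite -xs in X2; rewrite -ys in Y2.
(* The extra [1] gives strict room, so that by continuity [A] still bounds the three rates at times
   near [s]. *)
pose A := `|a s| + `|b s| + `|c s| + 1.
have A0 : 0 <= A by rewrite !addr_ge0.
pose B := A * (1 + `|gamma| + `|rho| + LG' + LF' + M).
have B0 : 0 <= B by rewrite mulr_ge0 ?addr_ge0.
(* A factor [2] comes from differentiating squares, [B] from the bound [B * N] on each velocity
   difference, and [4] from [sqr_sum4]. *)
exists (8 * B).
near=> r => _.
have aA : `|a r| <= A.
  near: r; apply: (cvgr_norm_le _ ac).
  have := (normr_ge0 (b s), normr_ge0 (c s)); rewrite /A; case; lra.
have bA : `|b r| <= A.
  near: r; apply: (cvgr_norm_le _ bc).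
  have := (normr_ge0 (a s), normr_ge0 (c s)); rewrite /A; case; lra.
have cA : `|c r| <= A.
  near: r; apply: (cvgr_norm_le _ cc).
  have := (normr_ge0 (b s), normr_ge0 (a s)); rewrite /A; case; lra.
have HGr : `|gradG (x1 r) - gradG (x2 r)| <= LG' * `|x1 r - x2 r|.
  by apply: HG; near: r; exact: cvgr_dist_lt.
have HFr : `|gradFs (y1 r) - gradFs (y2 r)| <= LF' * `|y1 r - y2 r|.
  by apply: HF; near: r; exact: cvgr_dist_lt.
have HKs := KsM (e1 r) (e2 r).
have HK : `|K (z1 r) - K (z2 r)| <= M * `|z1 r - z2 r| by rewrite -linearB.
have dxE : `|dx r| <= A * (`|x1 r - x2 r| + `|z1 r - z2 r|).
  rewrite [X in A * X]addrC /dx -scalerBr subrACA normrZ.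
  apply: ler_pM => //; exact: ler_normB.
have dyE : `|dy r| <= A * (`|y1 r - y2 r| + `|e1 r - e2 r|).
  rewrite [X in A * X]addrC /dy -scalerBr subrACA normrZ.
  apply: ler_pM => //; exact: ler_normB.
have dzE : `|dz r| <= A * (`|gamma| * (`|x1 r - x2 r| + `|z1 r - z2 r|)
    + LG' * `|x1 r - x2 r| + M * `|e1 r - e2 r|).
  rewrite /dz -scalerBr subrACA (subrACA _ (gradG (x1 r))) -scalerBr (subrACA (x1 r)) normrZ.
  apply: ler_pM => //.
  apply: le_trans (ler_normB _ _) _; apply: lerD => //.
  apply: le_trans (ler_normB _ _) _; apply: lerD => //.
  by rewrite normrZ ler_wpM2l // ler_normB.
have deE : `|de r| <= A * (`|rho| * (`|y1 r - y2 r| + `|e1 r - e2 r|)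
    + LF' * `|y1 r - y2 r| + M * `|z1 r - z2 r|).
  rewrite /de -scalerBr opprD addrACA (subrACA _ (gradFs (y1 r))) -scalerBr (subrACA (y1 r)) normrZ.
  apply: ler_pM => //.
  apply: le_trans (ler_normD _ _) _; apply: lerD => //.
  apply: le_trans (ler_normB _ _) _; apply: lerD => //.
  by rewrite normrZ ler_wpM2l // ler_normB.
pose N := `|x1 r - x2 r| + `|y1 r - y2 r| + `|z1 r - z2 r| + `|e1 r - e2 r|.
have N0 : 0 <= N by rewrite !addr_ge0.
have [[pmN qnN] [pN qN mN nN]] := le_sum4 (normr_ge0 (x1 r - x2 r))
  (normr_ge0 (y1 r - y2 r)) (normr_ge0 (z1 r - z2 r)) (normr_ge0 (e1 r - e2 r)).
rewrite -/N in pmN qnN pN qN mN nN.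
have DH (H : hilbertType R) (d u : H) : `|d| <= B * N ->
    2 * '<< d, u >> <= 2 * (B * N) * `|u|.
  move=> dt; rewrite -mulrA ler_pM2l //; apply: le_trans (hdot_le _ _) _.
  by rewrite ler_wpM2r.
have {}dxE : `|dx r| <= B * N.
  apply: le_trans dxE _.
  have := @rate_le _ A `|gamma| LG' M `|rho| LF' N (`|x1 r - x2 r| + `|z1 r - z2 r|) 0 0 0.
  rewrite !mulr0 !addr0; apply => //.
have {}dyE : `|dy r| <= B * N.
  apply: le_trans dyE _.
  have := @rate_le _ A `|gamma| LG' M `|rho| LF' N (`|y1 r - y2 r| + `|e1 r - e2 r|) 0 0 0.
  rewrite !mulr0 !addr0; apply => //.
have {}dzE : `|dz r| <= B * N.
  apply: le_trans dzE _; rewrite -[`|gamma| * _]add0r.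
  by apply: rate_le => //.
have {}deE : `|de r| <= B * N.
  apply: le_trans deE _; rewrite -[`|rho| * _]add0r.
  (* For the dual variable the pairs [gamma], [LG'] and [rho], [LF'] exchange roles, so [B] is
     reordered first. *)
  rewrite (_ : B = A * (1 + `|rho| + `|gamma| + LF' + LG' + M)).
    by apply: rate_le => //.
  by rewrite /B (addrAC 1) (addrAC _ LG').
have := DH _ _ (x1 r - x2 r) dxE; have := DH _ _ (y1 r - y2 r) dyE.
have := DH _ _ (z1 r - z2 r) dzE; have := DH _ _ (e1 r - e2 r) deE.
move=> He Hz Hy Hx.
apply: (@le_trans _ _ (2 * B * N ^+ 2)).
  rewrite /dE; apply: le_trans (lerD (lerD (lerD Hx Hy) Hz) He) _.
  by rewrite -!mulrDr -/N expr2 !mulrA.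
rewrite (_ : 8 * B = 2 * B * 4); last by ring.
rewrite -(mulrA (2 * B) 4); apply: ler_wpM2l; first exact: mulr_ge0.
exact: sqr_sum4.
Unshelve. all: by end_near. Qed.
End Uniqueness.

(** * Explicit integration of the scalar equations *)

Section TimeChange.
Context {R : realType}.

Lemma halfline_is_derive_ge0 (f df : R -> R) :
  (forall s : R, 0 <= s -> is_derive s (1 : R) f (df s)) ->
  (forall s : R, 0 <= s -> 0 <= df s) -> forall s : R, 0 <= s -> f 0 <= f s.
Proof.
move=> fD df0 s; rewrite le_eqVlt => /predU1P[<-//|s0].
have fI c : c \in `]0, s[ -> is_derive c (1 : R) f (df c).
  by rewrite in_itv /= => /andP[c0 _]; apply: fD; exact: ltW.
have fc : {within `[0, s], continuous f}.
  apply: derivable_within_continuous => c.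
  by rewrite in_itv /= => /andP[c0 _]; have [] := fD c c0.
have [c] := MVT s0 fI fc; rewrite in_itv /= => /andP[c0 _] E.
by rewrite -subr_ge0 E mulr_ge0 ?df0 ?subr_ge0 // ltW.
Qed.

Lemma halfline_is_derive0_cst (f : R -> R) :
  (forall s : R, 0 <= s -> is_derive s (1 : R) f 0) ->
  forall s : R, 0 <= s -> f s = f 0.
Proof.
move=> fD s s0; apply/eqP; rewrite eq_le; apply/andP; split; last first.
  exact: (@halfline_is_derive_ge0 f (cst 0)).
rewrite -lerN2; apply: (@halfline_is_derive_ge0 (- f) (cst 0)) => // r r0.
by rewrite /cst -oppr0; apply: is_deriveN; exact: fD.
Qed.

(** The function [f - k g] has zero derivative. This will express [phi] and [psi] affinely in
    [theta], in both systems. *)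
Lemma halfline_is_derive_proportional (f g df dg : R -> R) (k : R) :
  (forall s : R, 0 <= s -> is_derive s (1 : R) f (df s)) ->
  (forall s : R, 0 <= s -> is_derive s (1 : R) g (dg s)) ->
  (forall s : R, 0 <= s -> df s = k * dg s) ->
  forall s : R, 0 <= s -> f s = f 0 + k * (g s - g 0).
Proof.
move=> fD gD fg s s0.
have := @halfline_is_derive0_cst (f - k \*: g) _ s s0.
rewrite /= => H; suff : f s - k * g s = f 0 - k * g 0 by lra.
apply: H => r r0.
have D1 := is_deriveB (fD r r0) (@is_deriveZ R R R g k r 1 (dg r) (gD r r0)).
apply: (is_derive_eq D1).
by rewrite fg // [k *: _]/(k * _) subrr.
Qed.

(** The product [f r * expR (- r)] has zero derivative. *)
Lemma halfline_exponential (f : R -> R) :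
  (forall s : R, 0 <= s -> is_derive s (1 : R) f (f s)) ->
  forall s : R, 0 <= s -> f s = f 0 * expR s.
Proof.
move=> fD s s0.
have H : f s * expR (- s) = f 0 * expR (- 0).
  apply: (@halfline_is_derive0_cst (fun r => f r * expR (- r))) s0 => r r0.
  have D2 := is_derive1_comp (is_derive_expR (- r)) (is_deriveNid r (1 : R)).
  have D3 := is_deriveM (fD r r0) D2.
  apply: (is_derive_eq D3).
  rewrite /= /GRing.scale /=; ring.
by move: H; rewrite oppr0 expR0 mulr1 => <-; rewrite -mulrA -expRD addNr expR0 mulr1.
Qed.

End TimeChange.

(** * Both systems as rescaled flows *)

Section Systems.
Context {R : realType} {X Y : hilbertType R}.
Variables (K : {linear X -> Y}) (Ks : Y -> X) (gradG : X -> X) (gradFs : Y -> Y).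
Variables (gamma rho : R).

Lemma scaler_eq_div {V : lmodType R} {k l : R} {u v : V} :
  k != 0 -> k *: u = l *: v -> u = (l / k) *: v.
Proof. by move=> k0 kl; rewrite mulrC -scalerA -kl scalerA mulVf // scale1r. Qed.

(** Dividing each equation by its positive leading coefficient gives the rates. [P], [Q], [T] leave
    the values at negative times free, so that the rates can be chosen continuous on both sides of
    [0]. *)
Lemma solves_system_s_flow {phi psi theta : R -> R}
    {x : R -> X} {y : R -> Y} {zeta : R -> X} {eta : R -> Y} {P Q T : R -> R} :
  solves_system_s K Ks gradG gradFs gamma rho phi psi theta x y zeta eta ->
  (forall s : R, 0 <= s -> [/\ P s = phi s, Q s = psi s & T s = theta s]) ->
  rescaled_flow K Ks gradG gradFs gamma rho
    (fun s => Num.sqrt (P s * Q s) / T s)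
    (fun s => Num.sqrt (Q s) / Num.sqrt (P s))
    (fun s => Num.sqrt (P s) / Num.sqrt (Q s))
    (halfline_extension x) (halfline_extension y)
    (halfline_extension zeta) (halfline_extension eta).
Proof.
move=> [[_ _ _ dx dy dz de] phi0 psi0 theta0 _ _ Dt Dx Dy Dz De] PQT s s0.
have [-> -> ->] := PQT s s0; rewrite !halfline_extensionE //.
have t0 : theta s != 0 by rewrite gt_eqF // theta0.
have p0 : Num.sqrt (phi s) != 0 by rewrite gt_eqF // sqrtr_gt0 phi0.
have q0 : Num.sqrt (psi s) != 0 by rewrite gt_eqF // sqrtr_gt0 psi0.
have D1 := Dx s s0; have D2 := Dy s s0; rewrite Dt // in D1 D2.
split.
- by rewrite -(scaler_eq_div t0 D1); exact: is_derive_halfline_extension.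
- by rewrite -(scaler_eq_div t0 D2); exact: is_derive_halfline_extension.
- by rewrite -(scaler_eq_div p0 (Dz s s0)); exact: is_derive_halfline_extension.
- by rewrite -(scaler_eq_div q0 (De s s0)); exact: is_derive_halfline_extension.
Qed.

(** By the chain rule every velocity is multiplied by the derivative [a] of [t]. The averaging
    equations for [x] and [y] have rate [1] in the original time, hence rate [a] afterwards. *)
Lemma solves_system_t_flow {phi psi theta : R -> R}
    {x : R -> X} {y : R -> Y} {zeta : R -> X} {eta : R -> Y} {a b c t : R -> R} :
  solves_system_t K Ks gradG gradFs gamma rho phi psi theta x y zeta eta ->
  (forall s : R, 0 <= s -> 0 <= t s) ->
  (forall s : R, 0 <= s -> is_derive s (1 : R) t (a s)) ->
  (forall s : R, 0 <= s -> b s = a s * (theta (t s) / phi (t s))) ->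
  (forall s : R, 0 <= s -> c s = a s * (theta (t s) / psi (t s))) ->
  rescaled_flow K Ks gradG gradFs gamma rho a b c
    (halfline_extension x \o t) (halfline_extension y \o t)
    (halfline_extension zeta \o t) (halfline_extension eta \o t).
Proof.
move=> [[_ _ _ dx dy dz de] phi0 psi0 theta0 _ _ Dt Dx Dy Dz De] t0 td bE cE s s0.
rewrite /= !halfline_extensionE ?t0 //.
have p0 : phi (t s) != 0 by rewrite gt_eqF // phi0 // t0.
have q0 : psi (t s) != 0 by rewrite gt_eqF // psi0 // t0.
split.
- rewrite -Dx ?t0 //; apply: is_derive_comp (td s s0).
  by apply: is_derive_halfline_extension; rewrite ?t0.
- rewrite -Dy ?t0 //; apply: is_derive_comp (td s s0).
  by apply: is_derive_halfline_extension; rewrite ?t0.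
- rewrite bE // -scalerA -(scaler_eq_div p0 (Dz _ (t0 s s0))).
  apply: is_derive_comp (td s s0).
  by apply: is_derive_halfline_extension; rewrite ?t0.
- rewrite cE // -scalerA -(scaler_eq_div q0 (De _ (t0 s s0))).
  apply: is_derive_comp (td s s0).
  by apply: is_derive_halfline_extension; rewrite ?t0.
Qed.

End Systems.

(** * Matching the scalars, the rates and the curves *)

Theorem mainTheorem3 (R : realType) (X Y : hilbertType R)
    (K : {linear X -> Y}) (K_bounded : bounded_operator K)
    (Ks : Y -> X) (Ks_adjoint : is_adjoint K Ks)
    (gamma rho : R) (gamma_ge0 : 0 <= gamma) (rho_ge0 : 0 <= rho)
    (G : X -> R)
    (G_convex : @convex_function R X setT G)
    (G_gamma : has_convexity_constant gamma G)
    (G_C2 : twice_continuously_differentiable G)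
    (gradG : X -> X) (gradG_G : is_gradient G gradG)
    (F : Y -> \bar R) (F_proper : proper_fun F)
    (F_lsc : lower_semicontinuous F) (F_convex : econvex F)
    (Fs : Y -> R) (Fs_F : forall y, fenchel_conjugate F y = (Fs y)%:E)
    (Fs_convex : @convex_function R Y setT Fs)
    (Fs_rho : has_convexity_constant rho Fs)
    (Fs_C2 : twice_continuously_differentiable Fs)
    (gradFs : Y -> Y) (gradFs_Fs : is_gradient Fs gradFs)
    (phi psi theta : R -> R)
    (x : R -> X) (y : R -> Y) (zeta : R -> X) (eta : R -> Y)
    (sol_t : solves_system_t K Ks gradG gradFs gamma rho
               phi psi theta x y zeta eta)
    (phi' psi' theta' : R -> R)
    (x' : R -> X) (y' : R -> Y) (zeta' : R -> X) (eta' : R -> Y)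
    (sol_s : solves_system_s K Ks gradG gradFs gamma rho
               phi' psi' theta' x' y' zeta' eta')
    (phi_init : phi' 0 = phi 0) (psi_init : psi' 0 = psi 0)
    (theta_init : theta' 0 = theta 0)
    (x_init : x' 0 = x 0) (y_init : y' 0 = y 0)
    (zeta_init : zeta' 0 = zeta 0) (eta_init : eta' 0 = eta 0) :
  let t (s : R) : R := ln (theta' s) - ln (theta' 0) in
  forall s : R, 0 <= s ->
    phi' s = phi (t s) /\ psi' s = psi (t s) /\ theta' s = theta (t s) /\
    x' s = x (t s) /\ y' s = y (t s) /\
    zeta' s = zeta (t s) /\ eta' s = eta (t s).
Proof.
move=> t.
have LG := gradient_locally_lipschitz G_C2 gradG_G.
have LF := gradient_locally_lipschitz Fs_C2 gradFs_Fs.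
pose ext (f : R -> R) : R -> R := halfline_extension (f : R -> R^o).
have extE (f : R -> R) (s : R) : 0 <= s -> ext f s = f s.
  exact: (@halfline_extensionE R R^o).
have extD (f df : R -> R) : derivable_halfline (f : R -> R^o) ->
    (forall s, 0 <= s -> derive_halfline (f : R -> R^o) s = df s) ->
    forall s : R, 0 <= s -> is_derive s (1 : R) (ext f) (df s).
  move=> fd fD s s0; rewrite -(fD s s0).
  exact: (@is_derive_halfline_extension R R^o).
have [[dp dq dth _ _ _ _] p0 q0 th0 Dp Dq Dth _ _ _ _] := sol_t.
have [[dP dQ dT _ _ _ _] P0 Q0 T0 DP DQ DT _ _ _ _] := sol_s.
have {dp Dp}pD := extD _ _ dp Dp; have {dq Dq}qD := extD _ _ dq Dq.
have {dth Dth}thD := extD _ _ dth Dth.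
have {dP DP}PD := extD _ _ dP DP; have {dQ DQ}QD := extD _ _ dQ DQ.
have {dT DT}TD := extD _ _ dT DT.
have z0 := lexx (0 : R).
have thE (r : R) : 0 <= r -> theta r = theta 0 * expR r.
  move=> r0; rewrite -(extE theta r) // -(extE theta 0) //.
  apply: halfline_exponential => // s s0.
  by rewrite extE //; exact: thD.
have pE (r : R) : 0 <= r -> phi r = phi 0 + 2 * gamma * (theta r - theta 0).
  move=> r0; rewrite -(extE phi r) // -(extE phi 0) //
    -(extE theta r) // -(extE theta 0) //.
  have := @halfline_is_derive_proportional R _ _ _ _ _ pD thD (fun s _ => erefl) r r0.
  by apply.
have qE (r : R) : 0 <= r -> psi r = psi 0 + 2 * rho * (theta r - theta 0).
  move=> r0; rewrite -(extE psi r) // -(extE psi 0) //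
    -(extE theta r) // -(extE theta 0) //.
  have := @halfline_is_derive_proportional R _ _ _ _ _ qD thD (fun s _ => erefl) r r0.
  by apply.
have PE (r : R) : 0 <= r -> phi' r = phi' 0 + 2 * gamma * (theta' r - theta' 0).
  move=> r0; rewrite -(extE phi' r) // -(extE phi' 0) //
    -(extE theta' r) // -(extE theta' 0) //.
  have := @halfline_is_derive_proportional R _ _ _ _ _ PD TD (fun s _ => erefl) r r0.
  by apply.
have QE (r : R) : 0 <= r -> psi' r = psi' 0 + 2 * rho * (theta' r - theta' 0).
  move=> r0; rewrite -(extE psi' r) // -(extE psi' 0) //
    -(extE theta' r) // -(extE theta' 0) //.
  have := @halfline_is_derive_proportional R _ _ _ _ _ QD TD (fun s _ => erefl) r r0.
  by apply.
(* The derivative of [theta'] is a square root, hence nonnegative. This keeps [t s] in the half-line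
   on which the first system holds. *)
have Tle (s : R) : 0 <= s -> theta' 0 <= theta' s.
  move=> s0; rewrite -(extE theta' s) // -(extE theta' 0) //.
  by apply: halfline_is_derive_ge0 TD _ _ s0 => r _; exact: sqrtr_ge0.
have t0 (s : R) : 0 <= s -> 0 <= t s.
  by move=> s0; rewrite subr_ge0 ler_ln ?posrE ?T0 // Tle.
have tht (s : R) : 0 <= s -> theta (t s) = theta' s.
  move=> s0; rewrite thE ?t0 // /t expRD expRN !lnK ?posrE ?T0 //.
  by rewrite -theta_init mulrCA divff ?mulr1 // gt_eqF // T0.
have pht (s : R) : 0 <= s -> phi (t s) = phi' s.
  by move=> s0; rewrite pE ?t0 // tht // PE // -phi_init -theta_init.
have pst (s : R) : 0 <= s -> psi (t s) = psi' s.
  by move=> s0; rewrite qE ?t0 // tht // QE // -psi_init -theta_init.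
pose a (s : R) := Num.sqrt (ext phi' s * ext psi' s) / ext theta' s.
pose b (s : R) := Num.sqrt (ext psi' s) / Num.sqrt (ext phi' s).
pose c (s : R) := Num.sqrt (ext phi' s) / Num.sqrt (ext psi' s).
(* [T] agrees with [t] on the half-line, and the extension of [theta'] makes it differentiable on
   both sides of [0]. *)
pose T (s : R) := ln (ext theta' s) - ln (theta' 0).
have TE (s : R) : 0 <= s -> T s = t s by move=> s0; rewrite /T extE.
have TDa (s : R) : 0 <= s -> is_derive s (1 : R) T (a s).
  move=> s0; have T0s : 0 < ext theta' s by rewrite extE // T0.
  have D1 := is_derive1_comp (is_derive1_ln T0s) (TD s s0).
  apply: (is_derive_eq (is_deriveB D1 (is_derive_cst (ln (theta' 0)) s (1 : R)))).
  by rewrite subr0 mulrC /a !extE.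
(* This identifies the rates: multiplying [sqrt (phi psi) / theta] by [theta / phi] gives
   [sqrt psi / sqrt phi], and symmetrically with [phi] and [psi] exchanged. *)
have sq (u v w : R) : 0 < u -> 0 < v -> 0 < w ->
    Num.sqrt v / Num.sqrt u = Num.sqrt (u * v) / w * (w / u).
  move=> u0 v0 w0; rewrite sqrtrM ?ltW // mulrA divfK ?gt_eqF //.
  have su : Num.sqrt u != 0 by rewrite gt_eqF // sqrtr_gt0.
  rewrite -[X in _ = _ / X](sqr_sqrtr (ltW u0)); field.
  by rewrite su.
have flow_s := solves_system_s_flow K Ks gradG gradFs gamma rho sol_s
  (fun s s0 => And3 (extE phi' s s0) (extE psi' s s0) (extE theta' s s0)).
have flow_t : rescaled_flow K Ks gradG gradFs gamma rho a b c
    (halfline_extension x \o T) (halfline_extension y \o T)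
    (halfline_extension zeta \o T) (halfline_extension eta \o T).
  apply: (solves_system_t_flow K Ks gradG gradFs gamma rho sol_t) => // s s0.
  - by rewrite TE // t0.
  - by rewrite TE // tht // pht // /a /b !extE //; apply: sq; auto.
  - by rewrite TE // tht // pst // /a /c !extE // [phi' s * _]mulrC; apply: sq; auto.
have abc (s : R) : 0 <= s ->
    [/\ a r @[r --> s] --> a s, b r @[r --> s] --> b s & c r @[r --> s] --> c s].
  move=> s0.
  have Pc := is_derive_continuous (PD s s0).
  have Qc := is_derive_continuous (QD s s0).
  have Tc := is_derive_continuous (TD s s0).
  have sc (f : R -> R) : f r @[r --> s] --> f s ->
      Num.sqrt (f r) @[r --> s] --> Num.sqrt (f s).
    by move=> fc; exact: (cvg_comp _ _ fc (@sqrt_continuous R (f s))).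
  have T0s : ext theta' s != 0 by rewrite gt_eqF // extE // T0.
  have sP0 : Num.sqrt (ext phi' s) != 0 by rewrite gt_eqF // sqrtr_gt0 extE // P0.
  have sQ0 : Num.sqrt (ext psi' s) != 0 by rewrite gt_eqF // sqrtr_gt0 extE // Q0.
  split; [exact: cvgM (sc _ (cvgM Pc Qc)) (cvgV T0s Tc)
    |exact: cvgM (sc _ Qc) (cvgV sP0 (sc _ Pc))
    |exact: cvgM (sc _ Pc) (cvgV sQ0 (sc _ Qc))].
(* Since the time change fixes [0], the two flows have the same initial values. *)
have TT0 : T 0 = 0 by rewrite /T extE // subrr.
move=> s s0.
have [||||] := rescaled_flow_unique K Ks gradG gradFs gamma rho a b c _ _ _ _ _ _ _ _
  K_bounded Ks_adjoint LG LF abc flow_s flow_t _ _ _ _ s s0;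
  rewrite /= ?TT0 ?TE // ?halfline_extensionE ?t0 //.
by move=> -> -> -> ->; rewrite pht // pst // tht.
Qed.
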